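(* Let $A$ be a commutative ring, $k\ge1$, $\vec s=(n_1,\dots,n_k)$ a tuple of positive integers, $X_\bullet=X_\bullet(\vec s;A)$ the diagonal simplicial tensor module with boundary $\partial$, and $\mathcal F^\bullet$ the shifted depth filtration. The spectral sequence of the filtered complex $(X_\bullet,\partial,\mathcal F^\bullet)$ satisfies $$E_1^{t,q}=0\qquad\text{for all }t,q.$$ Hence it collapses at the $E_1$-page.
   Context: Notation: $[p]=\{0,\dots,p\}$. For a shape $\vec s=(n_1,\dots,n_k)$ put $n=\min(n_1,\dots,n_k)-1$, $M_a(p)=n_a-1-n+p$ (so $M_a(p)\ge p$) and $I_p=\prod_{a=1}^k[M_a(p)]$ for $p\ge 0$. Let $\delta_i^q:[q-1]\to[q]$ be the increasing injection missing $i$, and $\Delta_i^p=\prod_{a=1}^k\delta_i^{M_a(p)}:I_{p-1}\to I_p$ ($p\ge1$, $0\le i\le p$). The diagonal simplicial tensor module has $X_p=A^{I_p}$ (all functions $T:I_p\to A$) and faces $d_i^p(T)=T\circ\Delta_i^p$; the boundary of the associated unaugmented chain complex is $\partial_p=\sum_{i=0}^p(-1)^id_i^p$ for $p\ge1$, with $\partial_0=0$ and $X_p=0$ for $p<0$. The shifted depth filtration is the decreasing filtration by subcomplexes, for $p\ge0$ and $t\in\mathbb Z$, $\mathcal F^tX_p=\{T\in X_p: T(m)=0\text{ unless }\min_a m_a\ge t+p\}$. In the associated spectral sequence, $E_0$ is the associated graded complex $\bigoplus_t\mathcal F^tX_\bullet/\mathcal F^{t+1}X_\bullet$ with differential $d^0$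 induced by $\partial$, and $E_1$ is the homology of $(E_0,d^0)$; the terms $E_1^{t,q}$ (with $q$ the complementary index) are the homology modules of the complex $\mathcal F^tX_\bullet/\mathcal F^{t+1}X_\bullet$ in the various degrees. *)

(* Defs.v *)
From HB Require Import structures.
From mathcomp Require Import all_boot all_order all_algebra.
From mathcomp Require Import generic_quotient ring_quotient.
From mathcomp Require Import boolp zify.

Set Implicit Arguments.
Unset Strict Implicit.
Unset Printing Implicit Defensive.

Import Order.TTheory GRing.Theory Num.Theory.

Local Open Scope ring_scope.
Local Open Scope quotient_scope.

(** * Quotient modules and subquotients

    [Quotient.quot] is the quotient of a zmodule by a subgroup; for a
    submodule [B] it inherits the scaling. *)

Section QuotientModule.
Variables (A : pzRingType) (V : lmodType A) (B : submodClosed V).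

(* [submodClosed] is stated over semirings and does not inherit from
   [zmodClosed]. *)
Lemma submod_rpredN : {in B, forall x, - x \in B}.
Proof. by move=> x Bx; rewrite -scaleN1r rpredZ. Qed.

Lemma submod_rpredB : {in B &, forall x y, x - y \in B}.
Proof. by move=> x y Bx By; rewrite rpredD ?submod_rpredN. Qed.

Definition subgroup_of : {pred V} := fun x => x \in B.
Lemma subgroup_of_closed : zmod_closed subgroup_of.
Proof. by split; [exact: rpred0 | exact: submod_rpredB]. Qed.
HB.instance Definition _ :=
  GRing.isZmodClosed.Build V subgroup_of subgroup_of_closed.

Definition qmod : Type := Quotient.quot subgroup_of.
HB.instance Definition _ := GRing.Zmodule.on qmod.
HB.instance Definition _ := EqQuotient.on qmod.

Definition qpi (x : V) : qmod := \pi_(Quotient.quot subgroup_of) x.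

Lemma qpi_eq x y : (qpi x == qpi y) = (x - y \in B).
Proof. by rewrite /qpi -Quotient.idealrBE. Qed.

Lemma qpiK (u : qmod) : qpi (repr u) = u.
Proof. exact: reprK. Qed.

Lemma qpi_is_zmod_morphism : zmod_morphism qpi.
Proof. by move=> x y; rewrite /qpi raddfB. Qed.

Definition qscale (a : A) (u : qmod) : qmod := qpi (a *: repr u).

Lemma qscale_pi a x : qscale a (qpi x) = qpi (a *: x).
Proof.
by apply/eqP; rewrite qpi_eq -scalerBr rpredZ // -qpi_eq qpiK.
Qed.

Lemma qpiD x y : qpi (x + y) = qpi x + qpi y.
Proof. by rewrite /qpi raddfD. Qed.

Lemma qscaleA a b u : qscale a (qscale b u) = qscale (a * b) u.
Proof. by rewrite -[u]qpiK !qscale_pi scalerA. Qed.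
Lemma qscale1 : left_id 1 qscale.
Proof. by move=> u; rewrite -[u]qpiK qscale_pi scale1r. Qed.
Lemma qscaleDr : right_distributive qscale +%R.
Proof.
by move=> a u v; rewrite -[u]qpiK -[v]qpiK -qpiD !qscale_pi scalerDr qpiD.
Qed.
Lemma qscaleDl v : {morph qscale^~ v : a b / a + b}.
Proof. by move=> a b; rewrite -[v]qpiK !qscale_pi scalerDl qpiD. Qed.

HB.instance Definition _ :=
  GRing.Zmodule_isLmodule.Build A qmod qscaleA qscale1 qscaleDr qscaleDl.

Lemma qpi_is_scalable : scalable qpi.
Proof. by move=> a x; rewrite -qscale_pi. Qed.
HB.instance Definition _ := GRing.isZmodMorphism.Build V qmod qpi
  qpi_is_zmod_morphism.
HB.instance Definition _ := GRing.isScalable.Build A V qmod *:%R qpi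
  qpi_is_scalable.

Lemma qpi_eq0 x : (qpi x == 0) = (x \in B).
Proof. by rewrite -(raddf0 qpi) qpi_eq subr0. Qed.

End QuotientModule.

Section Subquotient.
Variables (A : pzRingType) (V : lmodType A).

Inductive submod (Z : submodClosed V) := Submod x & x \in Z.
Definition submod_val Z (u : submod Z) := let: Submod x _ := u in x.

HB.instance Definition _ Z := [isSub for @submod_val Z].
HB.instance Definition _ Z := [Choice of submod Z by <:].
HB.instance Definition _ (Z : submodClosed V) :=
  [SubChoice_isSubLmodule of submod Z by <:].

(* The trace of B on Z, as a submodule of Z *)
Definition trace (Z B : submodClosed V) : {pred submod Z} :=
  fun u => val u \in B.
Lemma trace_closed Z B : subsemimod_closed (@trace Z B).
Proof.
split; first split.
- by rewrite unfold_in /trace raddf0 rpred0.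
- move=> u v Bu Bv; rewrite unfold_in /trace raddfD.
  exact: (rpredD (S := B) Bu Bv).
- move=> a u Bu; rewrite unfold_in /trace linearZ.
  exact: (rpredZ (s := B) a Bu).
Qed.
HB.instance Definition _ Z B :=
  GRing.isSubmodClosed.Build A (submod Z) (@trace Z B) (trace_closed Z B).

(* Z / (Z :&: B), that is Z / B whenever B is contained in Z *)
Definition subquot (Z B : submodClosed V) : lmodType A := qmod (@trace Z B).

Definition sqpi (Z B : submodClosed V) (x : V) (Zx : x \in Z) : subquot Z B :=
  qpi (@trace Z B) (Submod Zx).

Lemma sqpi_eq (Z B : submodClosed V) x y (Zx : x \in Z) (Zy : y \in Z) :
  (sqpi B Zx == sqpi B Zy) = (x - y \in B).
Proof. by rewrite /sqpi qpi_eq unfold_in /trace raddfB. Qed.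

Lemma sqpiP (Z B : submodClosed V) (u : subquot Z B) :
  exists x (Zx : x \in Z), u = sqpi B Zx.
Proof.
by case def_x: (repr u) => [x Zx]; exists x, Zx; rewrite -[LHS]qpiK def_x.
Qed.

Lemma sqpi_eq0 (Z B : submodClosed V) x (Zx : x \in Z) :
  (sqpi B Zx == 0) = (x \in B).
Proof. by rewrite /sqpi qpi_eq0. Qed.

End Subquotient.

(* The linear map Z / B -> Z' / B' induced by f *)
Section InducedMap.
Variables (A : pzRingType) (V W : lmodType A) (f : {linear V -> W}).
Variables (Z B : submodClosed V) (Z' B' : submodClosed W).
Hypothesis fZ : forall x, x \in Z -> f x \in Z'.
Hypothesis fB : forall x, x \in Z -> x \in B -> f x \in B'.

Definition induced (u : subquot Z B) : subquot Z' B' :=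
  sqpi B' (fZ (valP (repr u))).

Lemma induced_pi x (Zx : x \in Z) : induced (sqpi B Zx) = sqpi B' (fZ Zx).
Proof.
apply/eqP; rewrite /induced sqpi_eq -raddfB.
case: (repr _) (qpiK (sqpi B Zx)) => y Zy /= Ey.
apply: fB; first exact: submod_rpredB.
by rewrite -(sqpi_eq B Zy Zx) /sqpi Ey.
Qed.

Lemma induced_linear : linear induced.
Proof.
move=> a u v; have [x [Zx ->]] := sqpiP u; have [y [Zy ->]] := sqpiP v.
have Zxy : a *: x + y \in Z by rewrite rpredD ?rpredZ.
have -> : a *: sqpi B Zx + sqpi B Zy = sqpi B Zxy.
  rewrite /sqpi -linearP; congr (qpi _ _); exact: val_inj.
rewrite !induced_pi {2 3}/sqpi -linearP; congr (qpi _ _); apply: val_inj.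
by rewrite /= linearP.
Qed.

Definition induced_map : {linear subquot Z B -> subquot Z' B'} :=
  HB.pack induced
    (GRing.isLinear.Build A (subquot Z B) (subquot Z' B') *:%R induced
      induced_linear).
End InducedMap.

Section KernelImage.
Variables (A : pzRingType) (V W : lmodType A) (f : {linear V -> W}).

Definition ker_of : {pred V} := fun x => f x == 0.
Lemma ker_of_closed : subsemimod_closed ker_of.
Proof.
split; first split.
- by rewrite unfold_in /ker_of raddf0.
- by move=> x y /eqP fx /eqP fy; rewrite unfold_in /ker_of linearD fx fy addr0.
- by move=> a x /eqP fx; rewrite unfold_in /ker_of linearZ /= fx scaler0.
Qed.
HB.instance Definition _ := GRing.isSubmodClosed.Build A V ker_of ker_of_closed.

Definition im_of : {pred W} := fun y => `[< exists x, f x = y >].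
Lemma im_of_closed : subsemimod_closed im_of.
Proof.
split; first split.
- by apply/asboolP; exists 0; rewrite raddf0.
- move=> _ _ /asboolP[x <-] /asboolP[y <-]; apply/asboolP.
  by exists (x + y); rewrite raddfD.
- move=> a _ /asboolP[x <-]; apply/asboolP.
  by exists (a *: x); rewrite linearZ.
Qed.
HB.instance Definition _ := GRing.isSubmodClosed.Build A W im_of im_of_closed.
End KernelImage.

(** * Filtered chain complexes

    Complexes live in degrees [p >= 0].  The boundary is typed
    [X_p -> X_(p.-1)]; since [0.-1 = 0], the map out of degree 0 is required to
    vanish, which encodes [X_(-1) = 0]. *)

Record filtered_complex (A : pzRingType) := FilteredComplex {
  chain :> nat -> lmodType A;
  bd : forall p, {linear chain p -> chain p.-1};
  fil : int -> forall p, submodClosed (chain p);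
  bd0 : forall x, bd 0 x = 0;
  bd_bd : forall p x, bd p.-1 (bd p x) = 0;
  fil_dec : forall t p x, x \in fil (t + 1) p -> x \in fil t p;
  fil_bd : forall t p x, x \in fil t p -> bd p x \in fil t p.-1
}.

Section SpectralSequence.
Variables (A : pzRingType) (C : filtered_complex A).
Implicit Types (t q : int) (p r : nat).

(** ** The pages [E_0] and [E_1] *)

(* F^t X_p / F^(t+1) X_p *)
Definition E0 t p : lmodType A := subquot (fil C t p) (fil C (t + 1) p).

Definition d0 t p : {linear E0 t p -> E0 t p.-1} :=
  @induced_map A _ _ (bd C p) (fil C t p) (fil C (t + 1) p)
    (fil C t p.-1) (fil C (t + 1) p.-1)
    (@fil_bd A C t p) (fun x _ => @fil_bd A C (t + 1) p x).

(* the homology of F^t X / F^(t+1) X in degree p *)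
Definition gr_homology t p : lmodType A :=
  subquot (ker_of (d0 t p)) (im_of (d0 t p.+1 : {linear _ -> E0 t p})).

(* E_1^{t,q} is the term of total degree t + q; in negative degrees the complex
   is zero, and functions on [void] form the zero module. *)
Definition E1 t q : lmodType A :=
  match t + q with
  | Posz p => gr_homology t p
  | Negz _ => {ffun void -> A^o}
  end.

(** ** All pages

    The standard description for a decreasing filtration: with
    [Z(a, b) = {x in F^a X_p | bd x in F^b X_(p-1)}], the term of
    [E_r] in filtration degree t is
    [Z(t, t + r) / (Z(t + 1, t + r) + bd Z(t - r + 1, t))],
    and [d^r] is induced by the boundary. *)

Definition almost_cycle (a b : int) p : {pred C p} :=
  fun x => (x \in fil C a p) && (bd C p x \in fil C b p.-1).
Lemma almost_cycle_closed a b p : subsemimod_closed (@almost_cycle a b p).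
Proof.
split; first split.
- by rewrite unfold_in /almost_cycle raddf0 !rpred0.
- move=> x y /andP[ax bx] /andP[ay b_y].
  by rewrite unfold_in /almost_cycle raddfD !rpredD.
- move=> c x /andP[ax bx].
  by rewrite unfold_in /almost_cycle linearZ !rpredZ.
Qed.
HB.instance Definition _ a b p :=
  GRing.isSubmodClosed.Build A (C p) (@almost_cycle a b p)
    (@almost_cycle_closed a b p).

Definition Zpage r t p : submodClosed (C p) := @almost_cycle t (t + r%:Z) p.

Definition Bpage r t p : {pred C p} := fun x =>
  `[< exists z y, [/\ z \in @almost_cycle (t + 1) (t + r%:Z) p,
                      y \in @almost_cycle (t - r%:Z + 1) t p.+1
                    & x = z + bd C p.+1 y] >].
Lemma Bpage_closed r t p : subsemimod_closed (@Bpage r t p).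
Proof.
split; first split.
- by apply/asboolP; exists 0, 0; rewrite raddf0 addr0 !rpred0.
- move=> _ _ /asboolP[z [y [Zz Zy ->]]] /asboolP[z' [y' [Zz' Zy' ->]]].
  apply/asboolP; exists (z + z'), (y + y'); split; rewrite ?rpredD //.
  by rewrite raddfD addrACA.
- move=> c _ /asboolP[z [y [Zz Zy ->]]]; apply/asboolP.
  by exists (c *: z), (c *: y); rewrite !rpredZ // linearZ scalerDr.
Qed.
HB.instance Definition _ r t p :=
  GRing.isSubmodClosed.Build A (C p) (@Bpage r t p) (@Bpage_closed r t p).

Definition page r t p : lmodType A := subquot (Zpage r t p) (@Bpage r t p).

Lemma Zpage_bd r t p x :
  x \in Zpage r t p -> bd C p x \in Zpage r (t + r%:Z) p.-1.
Proof.
by case/andP=> _ bx; rewrite unfold_in /= /almost_cycle bx bd_bd rpred0.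
Qed.

Lemma Bpage_bd r t p x : x \in Zpage r t p ->
  x \in @Bpage r t p -> bd C p x \in @Bpage r (t + r%:Z) p.-1.
Proof.
case: p x => [|p] x _ /asboolP[z [y [/andP[Fz Fbz] _ ->]]].
  by rewrite bd0 rpred0.
apply/asboolP; exists 0, z; rewrite rpred0 add0r; split=> //.
  by rewrite unfold_in /almost_cycle addrK Fz.
have bby : bd C p.+1 (bd C p.+2 y : C p.+1) = 0 := bd_bd (p := p.+2) y.
by rewrite linearD bby addr0.
Qed.

Definition dpage r t p : {linear page r t p -> page r (t + r%:Z) p.-1} :=
  @induced_map A _ _ (bd C p) (Zpage r t p) (@Bpage r t p)
    (Zpage r (t + r%:Z) p.-1) (@Bpage r (t + r%:Z) p.-1)
    (@Zpage_bd r t p) (@Bpage_bd r t p).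

(* collapse at the page E_r0: no nonzero differential from there on *)
Definition collapses_at r0 : Prop :=
  forall r t p, (r0 <= r)%N -> forall u : page r t p, dpage r t p u = 0.

(** [page 1] is isomorphic to the homology of [(E_0, d^0)], via the class of a
    representative. *)

Lemma d0_pi t p x (Fx : x \in fil C t p) :
  d0 t p (sqpi (fil C (t + 1) p) Fx) =
  sqpi (fil C (t + 1) p.-1) (fil_bd Fx).
Proof.
exact: (induced_pi (@fil_bd A C t p) (fun x _ => @fil_bd A C (t + 1) p x)).
Qed.

Section FirstPage.
Variables (t : int) (p : nat).

Lemma Zpage1_fil x : x \in Zpage 1 t p -> x \in fil C t p.
Proof. by case/andP=> Fx _; exact: Fx. Qed.

Definition Zpage1_cls x (Zx : x \in Zpage 1 t p) : E0 t p :=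
  sqpi (fil C (t + 1) p) (Zpage1_fil Zx).

Lemma Zpage1_ker x (Zx : x \in Zpage 1 t p) : Zpage1_cls Zx \in ker_of (d0 t p).
Proof.
by rewrite unfold_in /ker_of /Zpage1_cls d0_pi sqpi_eq0; case/andP: Zx.
Qed.

Lemma Zpage1_im x (Zx : x \in Zpage 1 t p) :
  (Zpage1_cls Zx \in im_of (d0 t p.+1 : {linear _ -> E0 t p})) =
  (x \in @Bpage 1 t p).
Proof.
have tE : t - 1%:Z + 1 = t := subrK 1 t.
apply/asboolP/asboolP => [[u]|[z [y [/andP[Fz _] /andP[Fy _] def_x]]]].
  have [y [Fy ->]] := sqpiP u; rewrite d0_pi => /eqP.
  rewrite sqpi_eq -[_ - x]opprB => Fbyx.
  have {}Fbyx : x - bd C p.+1 y \in fil C (t + 1) p.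
    by rewrite -[x - _]opprK submod_rpredN.
  exists (x - bd C p.+1 y), y; rewrite tE; split; last by rewrite subrK.
    rewrite unfold_in /almost_cycle Fbyx /=.
    have bby : bd C p (bd C p.+1 y : C p) = 0 := bd_bd (p := p.+1) y.
    by rewrite linearB bby subr0; case/andP: Zx.
  by rewrite unfold_in /almost_cycle Fy fil_bd.
have {}Fy : y \in fil C t p.+1 by move: Fy; rewrite tE.
exists (sqpi _ Fy); rewrite d0_pi; apply/eqP; rewrite sqpi_eq def_x.
by rewrite opprD addrCA subrr addr0 submod_rpredN.
Qed.

Definition page1_to_E1 (u : page 1 t p) : gr_homology t p :=
  sqpi _ (Zpage1_ker (valP (repr u))).

Lemma Zpage1_clsB x y (Zx : x \in Zpage 1 t p) (Zy : y \in Zpage 1 t p) 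
  (Zxy : x - y \in Zpage 1 t p) :
  Zpage1_cls Zx - Zpage1_cls Zy = Zpage1_cls Zxy.
Proof.
by rewrite /Zpage1_cls /sqpi -raddfB; congr (qpi _ _); apply: val_inj.
Qed.

Lemma page1_to_E1_pi x (Zx : x \in Zpage 1 t p) :
  page1_to_E1 (sqpi _ Zx) = sqpi _ (Zpage1_ker Zx).
Proof.
apply/eqP; rewrite /page1_to_E1 sqpi_eq.
case: (repr _) (qpiK (sqpi (@Bpage 1 t p) Zx)) => y Zy /= Ey.
rewrite (Zpage1_clsB _ _ (submod_rpredB (valP (Submod Zy)) Zx)) Zpage1_im.
by rewrite -(sqpi_eq (@Bpage 1 t p) Zy Zx) /sqpi Ey.
Qed.

Lemma page1_to_E1_linear : linear page1_to_E1.
Proof.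
move=> a u v; have [x [Zx ->]] := sqpiP u; have [y [Zy ->]] := sqpiP v.
have Zxy : a *: x + y \in Zpage 1 t p by rewrite rpredD ?rpredZ.
have -> : a *: sqpi (@Bpage 1 t p) Zx + sqpi (@Bpage 1 t p) Zy =
          sqpi (@Bpage 1 t p) Zxy.
  by rewrite /sqpi -linearP; congr (qpi _ _); apply: val_inj.
rewrite !page1_to_E1_pi {2 3}/sqpi -linearP; congr (qpi _ _); apply: val_inj.
rewrite /= /Zpage1_cls {2 3}/sqpi -linearP; congr (qpi _ _); exact: val_inj.
Qed.
HB.instance Definition _ :=
  GRing.isLinear.Build A (page 1 t p) (gr_homology t p) *:%R page1_to_E1
    page1_to_E1_linear.

Lemma page1_to_E1_inj : injective page1_to_E1.
Proof.
move=> u v; have [x [Zx ->]] := sqpiP u; have [y [Zy ->]] := sqpiP v.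
rewrite !page1_to_E1_pi => /eqP; rewrite sqpi_eq.
rewrite (Zpage1_clsB _ _ (submod_rpredB Zx Zy)) Zpage1_im => Bxy.
by apply/eqP; rewrite sqpi_eq.
Qed.

Lemma page1_to_E1_surj (w : gr_homology t p) : exists u, page1_to_E1 u = w.
Proof.
have [e [ke ->]] := sqpiP w; have [x [Fx def_e]] := sqpiP e.
have Zx : x \in Zpage 1 t p.
  rewrite unfold_in /= /almost_cycle Fx /= -(sqpi_eq0 _ (fil_bd Fx)) -d0_pi.
  by rewrite -def_e.
exists (sqpi _ Zx); rewrite page1_to_E1_pi; apply/eqP; rewrite sqpi_eq.
rewrite def_e /Zpage1_cls (_ : sqpi _ _ - sqpi _ _ = 0) ?rpred0 //.
by apply/eqP; rewrite subr_eq0 sqpi_eq subrr rpred0.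
Qed.

End FirstPage.

End SpectralSequence.

(** * The diagonal simplicial tensor module and its depth filtration *)

(* The minimum of a nonempty family: the initial value is neutral. *)
Definition minf k (f : 'I_k -> nat) : nat :=
  \big[minn/(\max_(a < k) f a)%N]_(a < k) f a.

Lemma leq_minf k (f : 'I_k -> nat) x : (0 < k)%N ->
  (x <= minf f)%N = [forall a, x <= f a]%N.
Proof.
move=> k_gt0; apply/idP/forallP => [le_x a|le_x].
  apply: leq_trans le_x _; rewrite /minf; move: (\max_(_ < _) _)%N => x0.
  elim: (index_enum _) (mem_index_enum a) => // b r IH.
  rewrite inE big_cons => /predU1P[<-|/IH le_r]; first exact: geq_minl.
  exact: leq_trans (geq_minr _ _) le_r.
apply: (big_ind (fun y => x <= y)%N) => [|y z xy xz|a _] //.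
  exact: leq_trans (le_x (Ordinal k_gt0)) (leq_bigmax _).
by rewrite leq_min xy xz.
Qed.

Lemma minf_leS k (f g : 'I_k -> nat) :
  (forall a, f a <= (g a).+1)%N -> (minf f <= (minf g).+1)%N.
Proof.
move=> le_fg; case: (posnP k) => [k0|k_gt0].
  by move: f g le_fg; rewrite k0 => f g _; rewrite /minf !big_ord0.
have min_f a : (minf f <= f a)%N.
  by move: (leqnn (minf f)); rewrite leq_minf // => /forallP.
suff: ((minf f).-1 <= minf g)%N by lia.
rewrite leq_minf //; apply/forallP=> a; have := min_f a; have := le_fg a; lia.
Qed.

Section DiagonalTensor.
Variables (A : comPzRingType) (k : nat) (s : 'I_k -> nat).

Definition shape_dim : nat := (minf s - 1)%N.

(* The truncated subtractions are exact, as 1 <= minf s <= s a.  The order of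
   the summands makes M a p.+1 convertible to (M a p).+1. *)
Definition M (a : 'I_k) (p : nat) : nat := (p + (s a - 1 - shape_dim))%N.

(* multi-indices: the product over a of {0, ..., M a p} *)
Definition multi_index (p : nat) := {dffun forall a : 'I_k, 'I_(M a p).+1}.

(* [lift i] is the increasing injection missing i *)
Definition Delta p (i : 'I_p.+2) (m : multi_index p) : multi_index p.+1 :=
  [ffun a : 'I_k =>
     (lift (lshift (s a - 1 - shape_dim) i : 'I_(M a p.+1).+1) (m a)
      : 'I_(M a p.+1).+1)].

Definition tensor (p : nat) : lmodType A := {ffun multi_index p -> A^o}.

Definition face p (i : 'I_p.+2) (T : tensor p.+1) : tensor p :=
  [ffun m => T (Delta i m)].

Definition boundary p : tensor p -> tensor p.-1 :=
  match p with
  | 0 => fun _ => 0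
  | p'.+1 => fun T => \sum_(i < p'.+2) (-1) ^+ i *: face i T
  end.

Lemma boundary_linear p : linear (@boundary p).
Proof.
move=> c T U; case: p T U => [|p] T U /=; first by rewrite scaler0 addr0.
rewrite scaler_sumr -big_split /=; apply: eq_bigr => i _.
rewrite scalerA mulrC -scalerA -scalerDr; congr (_ *: _).
by apply/ffunP=> m; rewrite !ffunE.
Qed.
HB.instance Definition _ p :=
  GRing.isLinear.Build A (tensor p) (tensor p.-1) *:%R (@boundary p)
    (@boundary_linear p).

Lemma DeltaE p (i : 'I_p.+2) (m : multi_index p) a :
  Delta i m a = bump i (m a) :> nat.
Proof. by rewrite ffunE. Qed.

Lemma boundaryE p (T : tensor p.+1) (m : multi_index p) :
  boundary T m = \sum_(i < p.+2) (-1) ^+ i * T (Delta i m).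
Proof. by rewrite /= sum_ffunE; apply: eq_bigr => i _; rewrite !ffunE. Qed.

Lemma Delta_comm p (i j : nat) (m : multi_index p) :
  (i < j)%N -> (j < p.+3)%N ->
  Delta (inord j : 'I_p.+3) (Delta (inord i : 'I_p.+2) m) =
  Delta (inord i : 'I_p.+3) (Delta (inord j.-1 : 'I_p.+2) m).
Proof.
move=> ij jp; apply/ffunP=> a; apply: val_inj => /=; rewrite !DeltaE.
rewrite !inordK; [|lia..].
rewrite /bump; lia.
Qed.

Lemma boundary_boundary p (T : tensor p) : boundary (boundary T) = 0.
Proof.
case: p T => [|[|p]] T //; apply/ffunP=> m; rewrite [RHS]ffunE.
rewrite boundaryE.
under eq_bigr => i _ do rewrite boundaryE mulr_sumr.
rewrite pair_big /= (bigID (fun u : 'I_p.+2 * 'I_p.+3 => u.1 < u.2)%N) /=.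
pose h (u : 'I_p.+2 * 'I_p.+3) : 'I_p.+2 * 'I_p.+3 :=
  (inord (val u.2).-1, inord (val u.1)).
pose h' (u : 'I_p.+2 * 'I_p.+3) : 'I_p.+2 * 'I_p.+3 :=
  (inord (val u.2), inord (val u.1).+1).
rewrite [X in X + _](reindex_onto h' h) /=; last first.
  case=> i j /= ij; congr pair; apply: val_inj => /=; rewrite !inordK //=;
    have := ltn_ord i; have := ltn_ord j; lia.
rewrite (eq_bigl (fun u : 'I_p.+2 * 'I_p.+3 => ~~ (u.1 < u.2)%N)); last first.
  case=> i j /=; have lti := ltn_ord i; have ltj := ltn_ord j.
  rewrite /h /h' /=; case: (ltnP i j) => [ij|ji] /=.
    apply/negbTE/negP => /andP[lt_ji /eqP[_ /(congr1 val) /=]].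
    have := ltn_ord (inord j : 'I_p.+2); move: lt_ji.
    rewrite (inordK (m := i.+1)) //.
    move: (nat_of_ord (inord j : 'I_p.+2)) => j' lt_j'i lt_j'.
    rewrite inordK; lia.
  rewrite !inordK; [|lia..]; apply/andP; split; first lia.
  by apply/eqP; congr pair; apply: val_inj; rewrite /= inordK.
rewrite -big_split big1 // => -[i j] /=; rewrite -leqNgt => ji.
have lti := ltn_ord i; have ltj := ltn_ord j.
have ji' : (j < i.+1)%N by [].
have := Delta_comm m ji' lti; rewrite inord_val /= inord_val => ->.
rewrite !inordK; [|lia..]; rewrite !mulrA -!exprD.
by rewrite addnS exprS mulN1r addnC !mulNr addNr.
Qed.

Definition depth (t : int) (p : nat) : {pred tensor p} := fun T =>
  [forall m, (T m != 0) ==> (t + p%:Z <= (minf (fun a => m a : nat))%:Z)].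

Lemma depthP t p (T : tensor p) :
  reflect
    (forall m, T m != 0 -> t + p%:Z <= (minf (fun a => m a : nat))%:Z)
    (T \in @depth t p).
Proof. exact: 'forall_implyP. Qed.

Lemma depth_closed t p : subsemimod_closed (@depth t p).
Proof.
split; first split.
- by apply/depthP=> m; rewrite ffunE eqxx.
- move=> T U /depthP hT /depthP hU; apply/depthP=> m; rewrite ffunE.
  have [->|/hT//] := eqVneq (T m) 0; rewrite add0r; exact: hU.
- move=> c T /depthP hT; apply/depthP=> m; rewrite ffunE.
  have [->|/hT//] := eqVneq (T m) 0; by rewrite scaler0 eqxx.
Qed.
HB.instance Definition _ t p :=
  GRing.isSubmodClosed.Build A (tensor p) (@depth t p) (@depth_closed t p).

Lemma depth_dec t p (T : tensor p) : T \in @depth (t + 1) p -> T \in @depth t p.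
Proof. by move=> /depthP hT; apply/depthP=> m /hT; lia. Qed.

Lemma depth_boundary t p (T : tensor p) :
  T \in @depth t p -> boundary T \in @depth t p.-1.
Proof.
case: p T => [|p] T /depthP hT; apply/depthP=> m; first by rewrite ffunE eqxx.
rewrite boundaryE => nz.
have [i Ti] : exists i, T (Delta i m) != 0.
  have [/existsP//|/existsPn T0] :=
    boolP [exists i : 'I_p.+2, T (Delta i m) != 0].
  case/eqP: nz; apply: big1 => i _.
  by move: (T0 i); rewrite negbK => /eqP ->; rewrite mulr0.
have := hT _ Ti.
have : (minf (fun a => Delta i m a : nat) <= (minf (fun a => m a : nat)).+1)%N.
  by apply: minf_leS => a; rewrite DeltaE; exact: leq_add (leq_b1 _) (leqnn _).
rewrite /=; lia.
Qed.

Definition tensor_complex : filtered_complex A :=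
  @FilteredComplex A tensor (fun p => @boundary p) (fun t p => @depth t p)
    (fun _ => erefl) boundary_boundary depth_dec depth_boundary.

End DiagonalTensor.

(* Main.v *)
Require Import Defs.
From mathcomp Require Import all_boot all_order all_algebra.
From mathcomp Require Import boolp zify.

(** On [F^t / F^(t+1)] in degree [p] only the multi-indices of minimum
    [l = t + p] matter.  A face [Delta i] with [i <= min m] shifts every
    coordinate of [m] by one, while the others do not raise the minimum and
    hence vanish in the quotient.  So [d^0] is [sum_(i < l) (-1)^i] times the
    pull-back along the bijection [m |-> m + 1]: an isomorphism for [l] odd and
    zero for [l] even.  Hence every graded piece is exact, and vanishing of the
    first page forces that of all later ones. *)

Set Implicit Arguments.
Unset Strict Implicit.
Unset Printing Implicit Defensive.

Import GRing.Theory.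

Local Open Scope ring_scope.

Section AcyclicGraded.
Variables (A : pzRingType) (C : filtered_complex A).

(** Exactness of each [F^t / F^(t+1)], phrased on representatives to avoid quotients. *)
Definition graded_acyclic := forall (t : int) p (x : C p),
  x \in fil C t p -> bd C p x \in fil C (t + 1) p.-1 ->
  exists2 y : C p.+1,
    y \in fil C t p.+1 & x - bd C p.+1 y \in fil C (t + 1) p.

Hypothesis acyclic : graded_acyclic.

Lemma fil_decn t n p (x : C p) : x \in fil C (t + n%:Z) p -> x \in fil C t p.
Proof.
elim: n => [|n IH]; first by rewrite addr0.
by rewrite -addn1 PoszD addrA => /fil_dec.
Qed.

(** Exactness gives [x = (x - bd y) + bd y]; the first summand has the same boundary as [x] and lies
    one filtration step deeper. *)
Lemma acyclic_Zpage_sub_Bpage r t p (x : C p) :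
  (0 < r)%N -> x \in Zpage C r t p -> x \in @Bpage A C r t p.
Proof.
case: r => // r _ /andP[Fx]; rewrite -add1n PoszD => Fbx.
have [|y Fy Fz] := acyclic Fx; first by apply: (@fil_decn _ r); rewrite -addrA.
apply/asboolP; exists (x - bd C p.+1 y), y; split; last by rewrite subrK.
  rewrite unfold_in /almost_cycle Fz linearB.
  have -> : bd C p (bd C p.+1 y : C p) = 0 := bd_bd (p := p.+1) y.
  by rewrite subr0 -add1n PoszD.
rewrite unfold_in /almost_cycle fil_bd // andbT.
(* Here [r] is the page number minus one, so [F^t] is contained in [F^(t-r)]. *)
by apply: (@fil_decn _ r); rewrite (_ : _ + r%:Z = t) //; lia.
Qed.

Lemma acyclic_page_eq0 r t p (u : page C r t p) : (0 < r)%N -> u = 0.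
Proof.
move=> r_gt0; have [x [Zx ->]] := sqpiP u.
by apply/eqP; rewrite sqpi_eq0 acyclic_Zpage_sub_Bpage.
Qed.

Lemma acyclic_E1_eq0 t q (u : E1 C t q) : u = 0.
Proof.
move: u; rewrite /E1; case: (t + q) => [p|n] u; last by apply/ffunP; case.
by have [v <-] := page1_to_E1_surj u; rewrite (acyclic_page_eq0 v) // raddf0.
Qed.

Lemma acyclic_collapses : collapses_at C 1.
Proof. by move=> r t p r_gt0 u; rewrite (acyclic_page_eq0 u) // raddf0. Qed.

End AcyclicGraded.

Lemma minf_leq k (f : 'I_k -> nat) a : (minf f <= f a)%N.
Proof.
have k_gt0 : (0 < k)%N := leq_ltn_trans (leq0n a) (ltn_ord a).
by move: (leqnn (minf f)); rewrite leq_minf // => /forallP.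
Qed.

Lemma minf_attained k (f : 'I_k -> nat) : (0 < k)%N -> exists a, f a = minf f.
Proof.
move=> k_gt0; have [/existsP[a /eqP fa]|/existsPn nf] :=
  boolP [exists a, f a == minf f]; first by exists a.
have: (minf f < minf f)%N.
  rewrite leq_minf //; apply/forallP=> a.
  by rewrite ltn_neqAle eq_sym nf minf_leq.
by rewrite ltnn.
Qed.

Lemma sumr_sign_prefix (R : pzRingType) l n : (l <= n)%N ->
  \sum_(i < n | (i < l)%N) (-1) ^+ i = (odd l)%:R :> R.
Proof.
move=> le_ln; rewrite -(big_ord_widen _ (fun i => (-1) ^+ i)) //.
elim: l {le_ln} => [|l IH]; first by rewrite big_ord0.
rewrite big_ord_recr /= IH -signr_odd.
by case: (odd l); rewrite ?expr1 ?expr0 ?subrr ?add0r.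
Qed.

Section DepthGraded.
Variables (A : comPzRingType) (k : nat) (s : 'I_k -> nat).
Hypothesis k_gt0 : (0 < k)%N.

Definition mdepth p (m : multi_index s p) : nat :=
  minf (fun a => m a : nat).

(** A coordinate [a] where [s] is minimal has [M s a p = p]. *)
Lemma mdepth_leq p (m : multi_index s p) : (mdepth m <= p)%N.
Proof.
have [a sa] := minf_attained s k_gt0.
apply: leq_trans (minf_leq _ a) _.
by have := ltn_ord (m a); move: (nat_of_ord _) => x;
  rewrite /M /shape_dim sa subnn addn0.
Qed.

Lemma Delta_leq_mdepth p (i : 'I_p.+2) (m : multi_index s p) :
  (i <= mdepth m)%N -> Delta i m = Delta ord0 m.
Proof.
move=> le_im; apply/ffunP=> a; apply: val_inj; rewrite /= !DeltaE /bump.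
by rewrite (leq_trans le_im (minf_leq _ a)).
Qed.

(** A coordinate attaining the minimum lies below [i], so the face map fixes it. *)
Lemma mdepth_Delta_gt p (i : 'I_p.+2) (m : multi_index s p) :
  (mdepth m < i)%N -> (mdepth (Delta i m) <= mdepth m)%N.
Proof.
move=> lt_mi; have [a ma] := minf_attained (fun a => m a : nat) k_gt0.
apply: leq_trans (minf_leq _ a) _.
by rewrite DeltaE ma /bump (leqNgt i) lt_mi add0n leqnn.
Qed.

Lemma mdepth_Delta0 p (m : multi_index s p) :
  mdepth (Delta ord0 m) = (mdepth m).+1.
Proof.
apply/eqP; rewrite eqn_leq; apply/andP; split.
  by apply: minf_leS => a; rewrite DeltaE.
rewrite {1}/mdepth leq_minf //; apply/forallP=> a.
by rewrite DeltaE /bump leq0n ltnS minf_leq.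
Qed.

(** The inverse of [Delta ord0] on indices of positive depth. The argument of [inord] is always in
    range; only the truncation of [0.-1] loses information. *)
Definition unshift p (m : multi_index s p.+1) : multi_index s p :=
  [ffun a => inord (m a).-1].

Lemma unshiftK p (m : multi_index s p.+1) :
  (0 < mdepth m)%N -> Delta ord0 (unshift m) = m.
Proof.
move=> m_gt0; apply/ffunP=> a; apply: val_inj; rewrite /= DeltaE ffunE.
have ma_gt0 := leq_trans m_gt0 (minf_leq _ a).
have lt_m : (m a < (M s a p).+2)%N := ltn_ord (m a).
rewrite inordK /bump ?leq0n; lia.
Qed.

Lemma Delta0K p (m : multi_index s p) : unshift (Delta ord0 m) = m.
Proof.
apply/ffunP=> a; apply: val_inj; rewrite ffunE DeltaE /bump /= inordK //.
exact: ltn_ord.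
Qed.

Lemma depth_leq t p (T : tensor A s p) m :
  T \in @depth A k s t p -> (mdepth m)%:Z < t + p%:Z -> T m = 0.
Proof.
move=> /depthP FT lt_m; have [//|/FT] := eqVneq (T m) 0.
rewrite -/(mdepth m); lia.
Qed.

(** Faces with [i > mdepth m] land at depth at most [mdepth m], where [T] vanishes; the other
    [(mdepth m).+1] faces coincide and their signs alternate. *)
Lemma boundary_lowest t p (T : tensor A s p.+1) (m : multi_index s p) :
  T \in @depth A k s t p.+1 -> t + p%:Z = (mdepth m)%:Z ->
  boundary T m = (~~ odd (mdepth m))%:R * T (Delta ord0 m).
Proof.
move=> FT tp; have le_mp := mdepth_leq m.
rewrite boundaryE (bigID (fun i : 'I_p.+2 => i < (mdepth m).+1)%N) /=.
rewrite [X in _ + X]big1 => [|i]; last first.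
  rewrite -leqNgt => /mdepth_Delta_gt le_m.
  by rewrite (depth_leq FT) ?mulr0 //; lia.
rewrite addr0 -oddS -(@sumr_sign_prefix A _ p.+2) ?mulr_suml; last lia.
by apply: eq_bigr => i le_im; rewrite Delta_leq_mdepth.
Qed.

(** Such an [m] is the shift of an index of even depth, at which the boundary takes the value [T m];
    that value is zero modulo [F^(t+1)]. *)
Lemma depth_boundary_odd t p (T : tensor A s p) (m : multi_index s p) :
  T \in @depth A k s t p -> boundary T \in @depth A k s (t + 1) p.-1 ->
  t + p%:Z = (mdepth m)%:Z -> odd (mdepth m) -> T m = 0.
Proof.
case: p T m => [|p] T m FT FbT tp odd_m.
  (* In degree 0 the depth is 0, hence not odd. *)
  by have := mdepth_leq m; case: (mdepth m) odd_m.
have m_gt0 := odd_gt0 odd_m.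
have def_m := unshiftK m_gt0; have := mdepth_Delta0 (unshift m).
rewrite def_m => mS; have := boundary_lowest (m := unshift m) FT.
rewrite def_m (depth_leq FbT) => [bT|]; last by rewrite /=; lia.
rewrite bT; last lia.
by move: odd_m; rewrite mS /= => ->; rewrite mul1r.
Qed.

(** The inverse of the pull-back along [Delta ord0], extended by zero outside depth [l.+1]. *)
Definition primitive p l (T : tensor A s p) : tensor A s p.+1 :=
  [ffun m => if mdepth m == l.+1 then T (unshift m) else 0].

Lemma depth_primitive t p l (T : tensor A s p) :
  t + p%:Z = l%:Z -> primitive l T \in @depth A k s t p.+1.
Proof.
move=> tp; apply/depthP=> m; rewrite ffunE -/(mdepth m).
by case: (mdepth m =P l.+1) => [->|_]; [lia | rewrite eqxx].
Qed.

Lemma tensor_graded_acyclic : graded_acyclic (tensor_complex A s).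
Proof.
move=> t p T FT FbT.
(* If [T] vanishes at every index of depth [t + p], it already lies in [F^(t+1)]; this includes the
   case where no such index exists. *)
have [lP|] := boolP [forall m, (t + p%:Z == (mdepth m)%:Z) ==> (T m == 0)].
  exists 0; first exact: rpred0.
  rewrite raddf0 subr0; apply/depthP=> m Tm.
  have /depthP/(_ _ Tm) := FT; have /forallP/(_ m) := lP.
  by rewrite (negPf Tm) implybF -/(mdepth m); lia.
case/forallPn=> m0; rewrite negb_imply => /andP[/eqP tp Tm0].
have ev : ~~ odd (mdepth m0).
  by apply: contra Tm0 => od; rewrite (depth_boundary_odd FT FbT tp od).
have Fy := depth_primitive T tp.
exists (primitive (mdepth m0) T) => //; apply/depthP=> m.
rewrite -/(mdepth m) !ffunE => nz.
(* At depth [mdepth m0] the boundary of the primitive equals [T]; below it both vanish, and above it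
   the bound holds. *)
case: (ltngtP (mdepth m) (mdepth m0)) => [lt_m|lt_m|eq_m]; last 1 first.
- case/eqP: nz; have := boundary_lowest (m := m) Fy; rewrite eq_m => -> //.
  by rewrite ev mul1r ffunE mdepth_Delta0 eq_m eqxx Delta0K subrr.
- case/eqP: nz.
  by rewrite (depth_leq FT) ?(depth_leq (depth_boundary Fy)) ?subrr //=; lia.
- lia.
Qed.

End DepthGraded.

Theorem mainTheorem8 (A : comPzRingType) (k : nat) (s : 'I_k -> nat)
    (k_ge1 : (1 <= k)%N) (s_pos : forall a : 'I_k, (0 < s a)%N) :
  (forall (t q : int) (u : E1 (tensor_complex A s) t q), u = 0)
  /\ collapses_at (tensor_complex A s) 1.
Proof.
have acyclic := @tensor_graded_acyclic A k s k_ge1.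
by split; [exact: acyclic_E1_eq0 acyclic | exact: acyclic_collapses].
Qed.
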